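(* Let $n\ge 2$, let $k$ be an algebraically closed field, and let $w=w_1w_2\cdots w_r$ be a primitive word on the totally ordered alphabet $\{2<3<\cdots<n\}$. For $2\le i\le n$ put $z_i=\alpha_1\alpha_2\cdots\alpha_{i-1}\beta_{i-1}^{-1}\cdots\beta_2^{-1}\beta_1^{-1}$ and let $\psi(w)=z_{w_1}z_{w_2}\cdots z_{w_r}$, a band walk of $(Q_n,R_n)$. The following are equivalent: (i) $w$ is perfectly clustering; (ii) the band $\Lambda_n$-module $B_{\psi(w),1,\lambda}$ is a brick for some $\lambda\in k^\times$; (iii) the band $\Lambda_n$-module $B_{\psi(w),1,\lambda}$ is a brick for every $\lambda\in k^\times$.
   Context: Words. A word is primitive if it is non-empty and not a power $u^m$ ($m\ge2$) of another word. Two words are conjugate if they can be written $xy$ and $yx$. For a non-empty word $v$ of length $r$ over a totally ordered alphabet, list its $r$ conjugates (cyclic rotations) in weakly increasing lexicographic order; $BW(v)$ is the word formed by the last letters of these conjugates, in this order. The word $v$ is perfectly clustering if $v$ is primitive and $BW(v)$ is weakly decreasing. The algebra $\Lambda_n$. $Q_n$ is the quiver with vertices $1,\dots,n$ and, for each $1\le i\le n-1$, two arrows $\alpha_i,\beta_i: i+1\to i$. $R_n=\{\alpha_i\beta_{i+1},\ \beta_i\alpha_{i+1} : 1\le i\le n-2\}$, where paths are composed from right to left. $\Lambda_n=kQ_n/(R_n)$. Its left modules (finite-dimensional) are the representations of $Q_n$ over $k$ satisfying the relations $R_n$. Walks. For an arrow $\gamma$, introduce a formal inverse $\gamma^{-1}$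 with source and target exchanged. A walk $z=\gamma_r\cdots\gamma_1$ is a sequence of arrows or inverse arrows, with the target of $\gamma_s$ equal to the source of $\gamma_{s+1}$; it visits vertices $v_0,v_1,\dots,v_r$, where $\gamma_s$ goes from $v_{s-1}$ to $v_s$. It is a string walk if for all $s$, $\gamma_{s+1}\ne\gamma_s^{-1}$ and neither $\gamma_{s+1}\gamma_s$ nor $(\gamma_{s+1}\gamma_s)^{-1}$ is in $R_n$. A band walk is a string walk of positive length with $v_0=v_r$, which is primitive (not a proper power of another walk), all of whose powers are string walks. Band modules. For a band walk $z=\gamma_r\cdots\gamma_1$ and $\lambda\in k^\times=k\setminus\{0\}$, $B_{z,1,\lambda}$ is the representation with basis $\epsilon_0,\dots,\epsilon_{r-1}$, $\epsilon_s$ lying at vertex $v_s$, with the convention $\epsilon_r=\epsilon_0$. If $\gamma_s=\gamma$ is an arrow, then $\gamma$ maps $\epsilon_{s-1}$ to $\epsilon_s$ if $s<r$ and to $\lambda\epsilon_r$ if $s=r$; if $\gamma_s=\gamma^{-1}$ with $\gamma$ an arrow, then $\gamma$ maps $\epsilon_s$ to $\epsilon_{s-1}$ if $s<r$ and to $\lambda^{-1}\epsilon_{r-1}$ if $s=r$; arrows act by zero on basis vectors in all other cases. A module $M$ is a brick if $\mathrm{End}(M)\cong k$, i.e. its only endomorphisms are scalar multiples of the identity. *)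

(* Defs.v *)
From HB Require Import structures.
From mathcomp Require Import all_boot all_order all_algebra.

Set Implicit Arguments.
Unset Strict Implicit.
Unset Printing Implicit Defensive.

Import Order.TTheory GRing.Theory.

Local Open Scope ring_scope.

Definition power (T : Type) (m : nat) (u : seq T) : seq T :=
  flatten (nseq m u).

Definition primitive (T : Type) (w : seq T) : Prop :=
  w <> [::] /\ forall (u : seq T) (m : nat), (2 <= m)%N -> w <> power m u.

(* Listed with multiplicity: there are always [size v] of them. *)
Definition conjugates (T : Type) (v : seq T) : seq (seq T) :=
  [seq rot i v | i <- iota 0 (size v)].

Definition BW (d : Order.disp_t) (T : orderType d) (v : seq T) : seq T :=
  if v is x0 :: _ then
    [seq last x0 u | u : seqlexi T <-
       sort <=%O (conjugates v : seq (seqlexi T))]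
  else [::].

Definition perfectly_clustering (d : Order.disp_t) (T : orderType d)
    (w : seq T) : Prop :=
  primitive w /\ sorted >=%O (BW w).

(* A finite quiver with zero relations of length two: [zrel a b] means that   *)
(* the path [ab] is a relation, where [b] comes first (right-to-left          *)
(* composition).                                                              *)
Record bound_quiver := BoundQuiver {
  vertex : finType;
  arrow : finType;
  src : arrow -> vertex;
  tgt : arrow -> vertex;
  zrel : rel arrow
}.

(* The [eq_rect] only transports [rmap b x] along [tgt b = src a].            *)
Record qmodule (k : fieldType) (Q : bound_quiver) := QModule {
  rspace : vertex Q -> vectType k;
  rmap : forall a : arrow Q, 'Hom(rspace (src a), rspace (tgt a));
  rmap_zrel : forall (a b : arrow Q) (e : tgt b = src a), zrel a b ->
    forall x : rspace (src b),
      rmap a (eq_rect (tgt b) (fun v => rspace v : Type) (rmap b x) (src a) e)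
        = 0
}.

Definition is_endo (k : fieldType) (Q : bound_quiver) (M : qmodule k Q)
    (f : forall v : vertex Q, 'End(rspace M v)) : Prop :=
  forall a : arrow Q, (f (tgt a) \o rmap M a)%VF = (rmap M a \o f (src a))%VF.

(* The first clause excludes the zero module, for which End(0) = 0.           *)
Definition brick (k : fieldType) (Q : bound_quiver) (M : qmodule k Q) : Prop :=
  (exists v : vertex Q, \dim {: rspace M v} <> 0%N) /\
  forall f : (forall v : vertex Q, 'End(rspace M v)), is_endo f ->
    exists c : k, forall v : vertex Q, f v = c *: \1%VF.

(* [inl a] is the arrow [a] and [inr a] its formal inverse.                   *)
Definition letter (Q : bound_quiver) : Type := (arrow Q + arrow Q)%type.

HB.instance Definition _ (Q : bound_quiver) :=
  Finite.copy (letter Q) (arrow Q + arrow Q)%type.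

Section Walks.

Context {Q : bound_quiver}.
Implicit Types (g h : letter Q) (z : seq (letter Q)).

Definition direct (a : arrow Q) : letter Q := inl a.
Definition inverse (a : arrow Q) : letter Q := inr a.

Definition linv g : letter Q :=
  match g with inl a => inverse a | inr a => direct a end.

Definition lsrc g : vertex Q :=
  match g with inl a => src a | inr a => tgt a end.

Definition ltgt g : vertex Q :=
  match g with inl a => tgt a | inr a => src a end.

(* [hg] (first [g], then [h]) or its formal inverse is a relation.            *)
Definition lzrel h g : bool :=
  match h, g with
  | inl a, inl b => zrel a b
  | inr a, inr b => zrel b a
  | _, _ => false
  end.

(* A walk is listed in the order in which it is traversed: the walk written   *)
(* [g_r ... g_1] is the sequence [:: g_1; ...; g_r].                          *)
Definition walk z : bool := sorted (fun g h => ltgt g == lsrc h) z.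

Definition string_walk z : bool :=
  walk z && sorted (fun g h => (h != linv g) && ~~ lzrel h g) z.

Definition closed_walk z : bool :=
  if z is g :: z' then ltgt (last g z') == lsrc g else false.

Definition band_walk z : Prop :=
  [/\ string_walk z, closed_walk z, primitive z
    & forall m : nat, string_walk (power m z)].

End Walks.

Section BandModule.

Context {k : fieldType} {Q : bound_quiver}.
Variables (z : seq (letter Q)) (lambda : k).

Local Notation r := (size z).

(* The basis vectors are indexed by [s : 'I_r]; with 0-based indexing the     *)
(* letter g_(s+1), from v_s to v_(s+1), is [gam s], and the letter g_s, read  *)
(* cyclically with g_0 = g_r, is [gam (ord_pred s)].                          *)
Local Notation gam := (tnth (in_tuple z)).

Definition band_vertex (s : 'I_r) : vertex Q := lsrc (gam s).

Definition band_space (v : vertex Q) : vectType k :=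
  {ffun {s : 'I_r | band_vertex s == v} -> k^o}.

(* The coefficient on e_t of the image of e_s by the arrow [a].               *)
Definition band_coef (a : arrow Q) (s t : 'I_r) : k :=
  if gam s == direct a then
    (if s.+1 == r then lambda else 1) *+ (t == ordS s)
  else if gam (ord_pred s) == inverse a then
    (if s == 0%N :> nat then lambda^-1 else 1) *+ (t == ord_pred s)
  else 0.

Definition band_fun (a : arrow Q) (x : band_space (src a)) :
    band_space (tgt a) :=
  [ffun t => \sum_s x s * band_coef a (val s) (val t)].

Fact band_fun_is_linear (a : arrow Q) : linear (@band_fun a).
Proof.
move=> c x y; apply/ffunP=> t; rewrite !ffunE /GRing.scale /= mulr_sumr.
rewrite -big_split /=; apply: eq_bigr => s _.
by rewrite !ffunE mulrDl /GRing.scale /= mulrA.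
Qed.

HB.instance Definition _ (a : arrow Q) :=
  GRing.isLinear.Build k (band_space (src a)) (band_space (tgt a)) *:%R
    (@band_fun a) (@band_fun_is_linear a).

Definition band_map (a : arrow Q) :
    'Hom(band_space (src a), band_space (tgt a)) :=
  linfun (@band_fun a).

Lemma band_mapE (a : arrow Q) (x : band_space (src a)) :
  band_map a x = band_fun x.
Proof. by rewrite lfunE. Qed.

Lemma band_walk_lzrel (hz : band_walk z) (s : 'I_r) :
  ~~ lzrel (gam (ordS s)) (gam s).
Proof.
case: hz => _ _ _ /(_ 2); rewrite /power /= cats0 => /andP[_].
have g0 : letter Q := gam s.
have szz : size (z ++ z) = (r + r)%N by rewrite size_cat.
move/(sortedP g0)/(_ (s : nat)); rewrite szz.
have ltsr := ltn_ord s.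
have -> : (s.+1 < r + r)%N.
  by rewrite (leq_ltn_trans ltsr) // -addn1 leq_add2l (leq_ltn_trans _ ltsr).
move=> /(_ isT)/andP[_]; rewrite !(tnth_nth g0) /= !nth_cat ltsr.
move: ltsr; rewrite leq_eqVlt => /predU1P[eqSr|ltSr].
  by rewrite eqSr ltnn subnn modnn.
by rewrite ltSr modn_small.
Qed.

Lemma band_coef_zrel (hz : band_walk z) (a b : arrow Q) (s t u : 'I_r) :
  zrel a b -> band_coef b s t * band_coef a t u = 0.
Proof.
move=> ab; rewrite /band_coef; have [gs|_] := eqVneq (gam s) (direct b).
  have [->|_] := eqVneq t (ordS s); last by rewrite mulr0n mul0r.
  have := band_walk_lzrel hz s; rewrite ordSK gs.
  have [-> /=|_ _] := eqVneq (gam (ordS s)) (direct a); first by rewrite ab.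
  by rewrite (_ : direct b == inverse a = false) // mulr0.
have [gs|_] := eqVneq (gam (ord_pred s)) (inverse b); last by rewrite mul0r.
have [->|_] := eqVneq t (ord_pred s); last by rewrite mulr0n mul0r.
have := band_walk_lzrel hz (ord_pred (ord_pred s)); rewrite ord_predK gs.
rewrite (_ : inverse b == direct a = false) //.
have [-> /=|_ _] := eqVneq (gam (ord_pred (ord_pred s))) (inverse a).
  by rewrite ab.
by rewrite mulr0.
Qed.

Lemma band_space_cast (u v : vertex Q) (e : u = v) (x : band_space u)
    (s : {s : 'I_r | band_vertex s == v}) :
  exists2 s' : {s : 'I_r | band_vertex s == u}, val s' = val s &
    (eq_rect u (fun v => band_space v : Type) x v e : band_space v) s = x s'.
Proof. by case: v / e s => s; exists s. Qed.

Lemma band_map_zrel (hz : band_walk z) (a b : arrow Q) (e : tgt b = src a) :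
  zrel a b -> forall x : band_space (src b),
  band_map a (eq_rect (tgt b) (fun v => band_space v : Type) (band_map b x)
                (src a) e) = 0.
Proof.
move=> ab x; rewrite !band_mapE; apply/ffunP=> u; rewrite !ffunE.
apply: big1 => t _; have [t' eqt ->] := band_space_cast e (band_fun x) t.
rewrite ffunE mulr_suml big1 // => s _.
by rewrite -eqt -mulrA band_coef_zrel ?mulr0.
Qed.

Definition band_module (hz : band_walk z) : qmodule k Q :=
  QModule (band_map_zrel hz).

End BandModule.

Arguments band_module {k Q z} lambda hz.

(* The 0-based [i : 'I_n] stands for the vertex i + 1 of Q_n, and the pairs   *)
(* [(i, false)] and [(i, true)] with [i : 'I_n.-1] for the arrows             *)
(* alpha_(i+1) and beta_(i+1), from i + 2 to i + 1.                           *)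
Section LambdaQuiver.

Variable n : nat.

Definition Qn_arrow : finType := ('I_n.-1 * bool)%type.

Fact Qn_src_subproof (i : 'I_n.-1) : (i.+1 < n)%N.
Proof. by rewrite -ltn_predRL. Qed.

Definition Qn_src (a : Qn_arrow) : 'I_n := Ordinal (Qn_src_subproof a.1).

Definition Qn_tgt (a : Qn_arrow) : 'I_n := widen_ord (leq_pred n) a.1.

Definition Qn_zrel : rel Qn_arrow :=
  fun a b => (b.1 == a.1.+1 :> nat) && (a.2 != b.2).

Definition Qn : bound_quiver := BoundQuiver Qn_src Qn_tgt Qn_zrel.

Definition alpha (i : 'I_n.-1) : arrow Qn := (i, false).
Definition beta (i : 'I_n.-1) : arrow Qn := (i, true).

(* The letter [i : 'I_n.-1] stands for i + 2 in the alphabet {2 < ... < n}.   *)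
(* [zword i] is z_(i+2) as it is written, from left to right:                 *)
(* alpha_1 ... alpha_(i+1) beta_(i+1)^-1 ... beta_1^-1.                       *)
Definition zword (i : 'I_n.-1) : seq (letter Qn) :=
  [seq direct (alpha j) | j : 'I_n.-1 <- enum 'I_n.-1 & (j <= i)%N] ++
  rev [seq inverse (beta j) | j : 'I_n.-1 <- enum 'I_n.-1 & (j <= i)%N].

(* Reversed, since walks are listed in the order of traversal.                *)
Definition psi (w : seq 'I_n.-1) : seq (letter Qn) :=
  rev (flatten [seq zword i | i <- w]).

End LambdaQuiver.

(* Main.v *)
(* In the cyclic word psi(w) every alpha is traversed forwards and each beta  *)
(* backwards, so an endomorphism of the band module is a matrix indexed by    *)
(* pairs of positions whose equations only link (u, s) with (u + 1, s + 1):   *)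
(* equal letters propagate an entry (up to lambda), different letters force   *)
(* one of the two entries to vanish. An entry off the main diagonal survives  *)
(* iff it lies on a segment of equal letters with favourable mismatches at    *)
(* both ends, and restricted to the starting points of the blocks z_i this    *)
(* means that the cyclic word w has factors a u b and a' u b' with a > a' and *)
(* b > b'. Comparing the conjugates that start right after a and a', this is  *)
(* exactly a failure of BW(w) to be weakly decreasing. The twist by lambda    *)
(* can be gauged away off the diagonal, whence the independence of lambda.    *)

From HB Require Import structures.
Require Import Defs.
From mathcomp Require Import all_boot all_order all_algebra.
From mathcomp Require Import zify.

Set Implicit Arguments.
Unset Strict Implicit.
Unset Printing Implicit Defensive.

Local Open Scope ring_scope.
Import Order.TTheory GRing.Theory.

(** * Periodic words and clustering *)

(** Write an endomorphism of the band module as a matrix over pairs of positions in psi(w). No arrow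
    occurs in psi(w) in both directions, so each commutation equation couples only (u, s) with (u +
    1, s + 1) ([commutes_system], [system_commutes]), and [wrap_twist] removes lambda from these
    equations. A nonzero entry off the main diagonal then spreads along a stretch of equal letters,
    a factor substring on the column side and a submodule substring on the row side: a graph map.

    Each block z_i climbs from vertex 1 to i and comes back. A surviving stretch therefore meets a
    pair of block starts ([reach_corner]), and where it first meets blocks of different sizes the
    row must have the larger one ([block_lt]). Read in both directions, this gives factors a x b and
    a' x b' of the cyclic word with a > a' and b > b' ([diagonal_system_diag]). Conversely, such
    factors produce a graph map ([unclustered_graph_map], [graph_map_system]). By
    [perfectly_clusteringP] they exist exactly when BW has an ascent. Both [clustered_brick] and
    [brick_clustered] hold for each nonzero lambda, whence the equivalence of (ii) and (iii). *)

Section PeriodicWords.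
Local Open Scope nat_scope.
Variables (T : Type) (x0 : T).
Implicit Types (u w : seq T) (i j m t : nat).

(** The infinite periodic word: factors may run past the end of [w] with plain indices in nat. *)
Definition cyc w i : T := nth x0 w (i %% size w).

Lemma size_power m w : size (power m w) = m * size w.
Proof. by elim: m => //= m IH; rewrite /power /= size_cat -/(power m w) IH. Qed.

Lemma cycD w i : cyc w (i + size w) = cyc w i.
Proof. by rewrite /cyc modnDr. Qed.

Lemma nth_power m w i : i < m * size w -> nth x0 (power m w) i = cyc w i.
Proof.
elim: m i => // m IH i; rewrite /power /= -/(power m w) nth_cat => lti.
case: ltnP => [lt|le]; first by rewrite /cyc modn_small.
by rewrite IH ?ltn_subLR // -[in RHS](subnK le) cycD.
Qed.

Lemma mkseq_cyc m w : mkseq (cyc w) (m * size w) = power m w.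
Proof.
apply: (@eq_from_nth _ x0) => [|i]; rewrite size_mkseq ?size_power // => lti.
by rewrite nth_mkseq // nth_power.
Qed.

Lemma cyc_eqmod w i j : i = j %[mod size w] -> cyc w i = cyc w j.
Proof. by rewrite /cyc => ->. Qed.

(** The shift [j + i * (size w).-1] represents j - i modulo the length, without truncated
    subtraction. *)
Lemma cyc_shift w i j :
  (forall t, cyc w (i + t) = cyc w (j + t)) ->
  forall t, cyc w (t + (j + i * (size w).-1)) = cyc w t.
Proof.
case: w => [|x w] H t; first by rewrite /cyc !nth_nil.
rewrite addnCA -H addnCA -mulnS; apply: cyc_eqmod => /=.
by rewrite addnC modnMDl.
Qed.

Lemma cyc_mul w d c :
  (forall t, cyc w (t + d) = cyc w t) -> forall t, cyc w (t + c * d) = cyc w t.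
Proof.
by move=> H; elim: c => [|c IH] t; rewrite ?addn0 // mulSn addnA IH H.
Qed.

(* By Bezout the gcd of two periods of the two-sided infinite word is again a *)
(* period.                                                                    *)
Lemma primitive_period w d :
  primitive w -> (forall t, cyc w (t + d) = cyc w t) -> size w %| d.
Proof.
case=> w0 prim H; have r0 : 0 < size w by case: w w0 {prim H}.
have [->|d0] := posnP d; first exact: dvdn0.
have [a _ ga] := Bezoutr d r0; set g := gcdn _ _ in ga.
have Hg t : cyc w (t + g) = cyc w t.
  rewrite -(cyc_mul a H) -addnA; apply: cyc_eqmod.
  by rewrite -modnDmr (eqP ga) addn0.
have gr : g %| size w by exact: dvdn_gcdr.
have g0 : 0 < g by rewrite gcdn_gt0 d0.
case: (ltnP (size w %/ g) 2) => [lt|le]; last first.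
  (* If g is a proper divisor of the length, [w] is a power of its prefix of length g. *)
  case: (prim (take g w) _ le).
  have gle : g <= size w by exact: dvdn_leq.
  apply: (@eq_from_nth _ x0) => [|i ltir].
    by rewrite size_power size_takel // divnK.
  rewrite nth_power ?size_takel ?divnK // /cyc size_takel //.
  rewrite nth_take ?ltn_mod //.
  rewrite -[in LHS](modn_small ltir) -/(cyc w i) {1}(divn_eq i g) addnC.
  rewrite cyc_mul //.
  by rewrite /cyc modn_small // (leq_trans _ gle) // ltn_mod //.
suff -> : size w = g by exact: dvdn_gcdl.
suff e : size w %/ g = 1 by rewrite -(divnK gr) e mul1n.
by apply/eqP; rewrite eqn_leq -ltnS lt divn_gt0 // dvdn_leq.
Qed.

Lemma cyc_aligned w i j :
  primitive w -> (forall t, cyc w (i + t) = cyc w (j + t)) ->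
  i = j %[mod size w].
Proof.
move=> prim /cyc_shift/(primitive_period prim) dvd.
have r0 : 0 < size w by case: prim; case: (w).
have : i + (j + i * (size w).-1) = i %[mod size w].
  by rewrite -modnDmr (eqP dvd) addn0.
by rewrite addnCA -mulnS prednK // addnC modnMDl.
Qed.

Lemma rev_power m w : rev (power m w) = power m (rev w).
Proof. by rewrite /power rev_flatten map_nseq rev_nseq. Qed.

Lemma primitive_rev w : primitive w -> primitive (rev w).
Proof.
move=> [w0 prim]; split=> [/(congr1 rev)|u m le /(congr1 rev)].
  by rewrite revK.
by rewrite revK rev_power => /prim; apply.
Qed.

Lemma cyc_rev w N i : i < N * size w ->
  cyc (rev w) i = cyc w (N * size w - i.+1).
Proof.
move=> lti; rewrite -(@nth_power N) ?size_rev // -rev_power.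
by rewrite nth_rev size_power // nth_power //; lia.
Qed.

Lemma nth_rot w i t : i <= size w -> t < size w ->
  nth x0 (rot i w) t = cyc w (i + t).
Proof.
move=> lei ltt; rewrite /rot nth_cat size_drop; case: ltnP => [lt|le].
  by rewrite nth_drop /cyc modn_small // -ltn_subRL.
rewrite nth_take; last by rewrite ltn_subLR // subnK.
have -> : i + t = t - (size w - i) + size w by lia.
by rewrite cycD /cyc modn_small // (leq_ltn_trans _ ltt) ?leq_subr.
Qed.

End PeriodicWords.

(** * Perfect clustering as the absence of a pair of factors *)

Section Clustering.
Variables (d : Order.disp_t) (T : orderType d) (x0 : T).
Implicit Types (u v w : seq T) (W : nat -> T).
Local Open Scope nat_scope.

(** The obstruction: factors a x b and a' x b' with a > a' and b > b'; a and a' sit at [i] and [j],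
    and x has length [l]. *)
Definition unclustered W : Prop :=
  exists i j l, [/\ (W j < W i)%O,
    forall t, t < l -> W (i.+1 + t) = W (j.+1 + t)
    & (W (j.+1 + l) < W (i.+1 + l))%O].

Lemma ltxi_nthP u v : size u = size v ->
  reflect (exists l, [/\ l < size u, forall t, t < l -> nth x0 u t = nth x0 v t
                        & (nth x0 u l < nth x0 v l)%O])
    ((u : seqlexi T) < v)%O.
Proof.
elim: u v => [|x u IH] [|y v] //= => [_|[] szuv].
  by rewrite ltxx; apply: (iffP idP) => // -[l []].
rewrite ltxi_cons; apply: (iffP andP) => [[]|[[|l] [/= ltl eqt ltn]]].
- rewrite le_eqVlt => /predU1P[<-|ltxy _]; last by exists 0.
  rewrite lexx => /IH[] // l [ltl eqt ltn]; exists l.+1; split=> //.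
  by case=> // t; apply: eqt.
- by rewrite ltW // leNgt ltn.
have /= -> := eqt 0 isT; rewrite lexx; split=> //=.
by apply/IH => //; exists l; split=> // t ltt; apply: (eqt t.+1).
Qed.

(** Equal conjugates have equal last letters, so only strict comparisons matter and repetitions in
    the sorted list are harmless. *)
Lemma BW_sortedP w :
  reflect (forall i j, i < size w -> j < size w ->
             ((rot i w : seqlexi T) < rot j w)%O ->
             (last x0 (rot j w) <= last x0 (rot i w))%O)
    (sorted >=%O (BW w)).
Proof.
case: w => [|x w']; first by left.
set w := x :: w'; set s := sort <=%O (conjugates w : seq (seqlexi T)).
have lastx u : u != [::] -> last x u = last x0 u by case: u.
have rot0 i : rot i w != [::] by rewrite -size_eq0 size_rot.
have mem_s u : reflect (exists2 i, i < size w & u = rot i w) (u \in s).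
  rewrite mem_sort; apply: (iffP mapP) => -[i lti ->]; exists i => //.
    by move: lti; rewrite mem_iota.
  by rewrite mem_iota.
have srt : sorted <=%O s by apply: sort_sorted; apply: le_total.
rewrite /BW -/w -/s sorted_map; apply: (iffP idP) => [srt' i j lti ltj ltij|H].
  have [si sj] : (rot i w \in s) /\ (rot j w \in s).
    by split; apply/mem_s; [exists i | exists j].
  have le : index (rot i w) s <= index (rot j w) s.
    rewrite leqNgt; apply/negP => /ltnW le.
    have := @sorted_leq_nth (seqlexi T) _ le_trans lexx ([::] : seqlexi T) s srt.
    move/(_ _ _ _ _ le).
    by rewrite !inE !index_mem !nth_index // leNgt ltij; move=> /(_ sj si).
  have tr : transitive (relpre (last x) (>=%O : rel T)).
    by move=> ? ? ? /= le1 le2; apply: le_trans le2 le1.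
  have rf : reflexive (relpre (last x) (>=%O : rel T)) by move=> ? /=.
  have := @sorted_leq_nth (seqlexi T) _ tr rf ([::] : seqlexi T) s srt'.
  move/(_ _ _ _ _ le).
  by rewrite !inE !index_mem !nth_index //= !lastx //; apply.
apply: (sub_in_sorted (P := [in s])) srt; last by apply/allP.
move=> u v /mem_s[i lti ->] /mem_s[j ltj ->] /=; rewrite !lastx // le_eqVlt.
by case/predU1P=> [->//|]; apply: H.
Qed.

(** The conjugate starting right after a position ends with the letter at that position. The
    obstruction is thus a pair of conjugates, compared at their first difference, whose last letters
    increase. *)
Lemma perfectly_clusteringP w :
  primitive w -> perfectly_clustering w <-> ~ unclustered (cyc x0 w).
Proof.
move=> prim; have r0 : 0 < size w by case: w prim => // -[].
have lastE i : i < size w -> last x0 (rot i w) = cyc x0 w (i + (size w).-1).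
  move=> lti; rewrite -nth_last size_rot nth_rot ?prednK //; exact: ltnW.
split=> [[_ /BW_sortedP H] [i [j [l [ltW0 eqt ltWl]]]]|H].
  (* Agreement over a full period would, by primitivity, make the two positions congruent, leaving
     no mismatch at [l]. *)
  have ltl : l < size w.
    rewrite ltnNge; apply/negP => ler.
    have /(cyc_aligned prim) e t : cyc x0 w (i.+1 + t) = cyc x0 w (j.+1 + t).
      rewrite (@cyc_eqmod _ _ _ _ (i.+1 + t %% size w)) ?modnDmr // eqt.
        by apply: cyc_eqmod; rewrite modnDmr.
      by rewrite (leq_trans _ ler) // ltn_mod.
    move: ltWl; rewrite (@cyc_eqmod _ _ _ (i.+1 + l) (j.+1 + l)) ?ltxx //.
    by rewrite -modnDml e modnDml.
  have rotE a t : t < size w ->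
      nth x0 (rot (a.+1 %% size w) w) t = cyc x0 w (a.+1 + t).
    move=> ltt; rewrite nth_rot // ?(ltnW (ltn_pmod _ _)) //.
    by apply: cyc_eqmod; rewrite modnDml.
  have lastW a : last x0 (rot (a.+1 %% size w) w) = cyc x0 w a.
    rewrite lastE ?ltn_pmod //; apply: cyc_eqmod.
    by rewrite modnDml addSnnS prednK // modnDr.
  have := H (j.+1 %% size w) (i.+1 %% size w).
  rewrite !lastW !ltn_pmod // leNgt ltW0 => /(_ isT isT) nlt.
  apply: (notF (nlt _)); apply/ltxi_nthP; rewrite ?size_rot //.
  exists l; rewrite !rotE //; split=> //.
  by move=> t ltt; have ltt' := ltn_trans ltt ltl; rewrite !rotE ?eqt.
split=> //; apply/BW_sortedP => i j lti ltj /ltxi_nthP[|l []].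
  by rewrite !size_rot.
rewrite size_rot => ltl eqt; rewrite !nth_rot // 1?ltnW // => ltW0.
rewrite leNgt !lastE //; apply/negP => lt'; case: H.
(* Adding [(size w).-1] steps back by one position modulo the length. *)
exists (j + (size w).-1), (i + (size w).-1), l; split=> //; last first.
  by rewrite -!addnS prednK // ![_ + size w + _]addnAC !cycD.
move=> t ltt; rewrite -!addnS prednK // ![_ + size w + _]addnAC !cycD.
have ltt' := ltn_trans ltt ltl.
by have := eqt t ltt; rewrite !nth_rot // ltnW.
Qed.

(** Reading backwards exchanges a with b and a' with b', and both inequalities point the same way.
    This matters because [psi] reverses the order of the blocks. *)
Lemma unclustered_rev w :
  unclustered (cyc x0 (rev w)) -> unclustered (cyc x0 w).
Proof.
case=> i [j [l [ltW0 eqt ltWl]]].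
have r0 : 0 < size w.
  by case: (w) ltW0 => //; rewrite /cyc /rev /= !nth_nil ltxx.
pose K := (i + j + l).+2 * size w; have leK : (i + j + l).+2 <= K.
  by rewrite leq_pmulr.
have revE x : x <= (i + j + l).+1 -> cyc x0 (rev w) x = cyc x0 w (K - x.+1).
  by move=> lex; rewrite (@cyc_rev _ _ _ (i + j + l).+2) // (leq_trans _ leK).
exists (K - (i.+1 + l).+1), (K - (j.+1 + l).+1), l; split=> [|t ltt|].
- by rewrite -!revE //; lia.
- have -> : (K - (i.+1 + l).+1).+1 + t = K - (i.+1 + (l - t.+1)).+1 by lia.
  rewrite -revE; last by lia.
  have -> : (K - (j.+1 + l).+1).+1 + t = K - (j.+1 + (l - t.+1)).+1 by lia.
  by rewrite -revE; [apply: eqt; lia | lia].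
have -> : (K - (i.+1 + l).+1).+1 + l = K - i.+1 by lia.
have -> : (K - (j.+1 + l).+1).+1 + l = K - j.+1 by lia.
by rewrite -!revE //; lia.
Qed.

End Clustering.

(** * Diagonal systems *)

Lemma first_mismatch (T : eqType) (f g : nat -> T) (r : nat) :
  (exists2 t, t < r & f t != g t)%N ->
  (exists2 m, m < r & (forall t, t < m -> f t = g t) /\ f m != g m)%N.
Proof.
case=> t0 ltt0 neqt0; have ex : exists t, f t != g t by exists t0.
case: (ex_minnP ex) => m neqm minm; exists m.
  by apply: leq_ltn_trans ltt0; apply: minm.
split=> // t; apply: contraTeq => neqt; rewrite -leqNgt; exact: minm.
Qed.

Section Diagonals.
Variables (W : nat -> nat) (Z : nat -> bool * nat).
Implicit Types (i j l m p q s t u : nat).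
Local Open Scope nat_scope.

(** Starting position of block [j]; the 0-based letter h stands for z_(h+2), which has 2(h+1)
    letters. *)
Definition offset j := \sum_(i < j) (W i).+1.*2.

(* Position [p] in the block of a letter [h]: [(b, q)] stands for the letter  *)
(* alpha_(q+1) if [b], and for beta_(q+1)^-1 otherwise.                       *)
Definition block_code h p := if p <= h then (false, p) else (true, h.*2.+1 - p).

(** The 0-based source of the coded letter: beta_(q+1)^-1 starts at q and alpha_(q+1) at q + 1. *)
Definition code_vertex (c : bool * nat) := c.1 + c.2.

Lemma code_vertex_block h p :
  p < h.+1.*2 -> code_vertex (block_code h p) = minn p (h.+1.*2 - p).
Proof. by rewrite /block_code /code_vertex; case: ifP => /= ? ?; lia. Qed.

Hypothesis Z_offset :
  forall j p, p < (W j).+1.*2 -> Z (offset j + p) = block_code (W j) p.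

Lemma offsetS j : offset j.+1 = offset j + (W j).+1.*2.
Proof. by rewrite /offset big_ord_recr. Qed.

Lemma leq_offset i j : i <= j -> offset i <= offset j.
Proof.
move/subnKC<-; elim: (j - i) => [|m IH]; first by rewrite addn0.
by rewrite addnS offsetS (leq_trans IH) ?leq_addr.
Qed.

Lemma offset_decomp u : exists j p, p < (W j).+1.*2 /\ u = offset j + p.
Proof.
elim: u => [|_ [j [p [ltp ->]]]].
  by exists 0, 0; split; rewrite // /offset big_ord0.
have [lt|le] := ltnP p.+1 (W j).+1.*2; first by exists j, p.+1; rewrite addnS.
by exists j.+1, 0; split; rewrite // offsetS addn0 -addnS; congr addn; lia.
Qed.

Lemma Z_up j p : p <= W j -> Z (offset j + p) = (false, p).
Proof. by move=> le; rewrite Z_offset /block_code ?le //; lia. Qed.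

Lemma Z_down j p : p <= W j -> Z (offset j + ((W j).*2.+1 - p)) = (true, p).
Proof.
move=> le; rewrite Z_offset /block_code; last by lia.
by rewrite ifN; [congr pair|]; lia.
Qed.

Lemma Z_adjacent u : (Z u).2 + ~~ (Z u).1 = code_vertex (Z u.+1).
Proof.
have [j [p [ltp ->]]] := offset_decomp u.
have [lt|le] := ltnP p.+1 (W j).+1.*2.
  rewrite -addnS !Z_offset // code_vertex_block // /block_code.
  by case: ifP => /= ?; lia.
have ep : p = (W j).*2.+1 - 0 by lia.
rewrite ep Z_down //= -addnS.
have -> : offset j + ((W j).*2.+1 - 0).+1 = offset j.+1 + 0.
  by rewrite offsetS; lia.
by rewrite Z_up.
Qed.

(** * Vanishing off the main diagonal *)

Section Vanishing.
Variables (V : nmodType) (X : nat -> nat -> V).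

(* The equations on the matrix coefficients of an endomorphism: [X u s] is    *)
(* the coefficient on e_u of the image of e_s.                                *)
Definition diagonal_system : Prop :=
  [/\ forall u s, code_vertex (Z u) <> code_vertex (Z s) -> X u s = 0%R,
      forall u s, Z u = Z s -> X u s = X u.+1 s.+1,
      forall u s, Z u <> Z s -> (Z u).1 || ~~ (Z s).1 -> X u s = 0%R
    & forall u s, Z u <> Z s -> ~~ (Z u).1 || (Z s).1 -> X u.+1 s.+1 = 0%R].

Hypothesis XP : diagonal_system.

Lemma run u s m :
  (forall t, t < m -> Z (u + t) = Z (s + t)) -> X u s = X (u + m) (s + m).
Proof.
case: XP => _ eqX _ _; elim: m => [|m IH] H; first by rewrite !addn0.
by rewrite IH => [|t ltt]; [rewrite !addnS; apply/eqX/H | apply/H/ltnW].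
Qed.

Lemma run_up i j m : m <= (W i).+1 -> m <= (W j).+1 ->
  X (offset i) (offset j) = X (offset i + m) (offset j + m).
Proof. by move=> lei lej; apply: run => t ltt; rewrite !Z_up //; lia. Qed.

Lemma run_down i j m : m <= (W i).+1 -> m <= (W j).+1 ->
  X (offset i + ((W i).+1.*2 - m)) (offset j + ((W j).+1.*2 - m)) =
  X (offset i.+1) (offset j.+1).
Proof.
move=> lei lej; rewrite (@run _ _ m) => [|t ltt].
  by rewrite !offsetS; congr X; lia.
have -> : offset i + ((W i).+1.*2 - m) + t =
          offset i + ((W i).*2.+1 - (m - t.+1)) by lia.
have -> : offset j + ((W j).+1.*2 - m) + t =
          offset j + ((W j).*2.+1 - (m - t.+1)) by lia.
by rewrite !Z_down //; lia.
Qed.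

Lemma block_eq i j : W i = W j ->
  X (offset i) (offset j) = X (offset i.+1) (offset j.+1).
Proof.
move=> eqW; rewrite (@run_up _ _ (W i).+1) ?eqW //.
rewrite -(@run_down _ _ (W i).+1) ?eqW //; congr X; lia.
Qed.

Lemma block_run i j m : (forall t, t < m -> W (i + t) = W (j + t)) ->
  X (offset i) (offset j) = X (offset (i + m)) (offset (j + m)).
Proof.
elim: m => [|m IH] H; first by rewrite !addn0.
by rewrite IH => [|t ltt]; [rewrite !addnS; apply/block_eq/H | apply/H/ltnW].
Qed.

(** The smaller block turns first: at its peak the row descends while the column still climbs, a
    mismatch that kills the entry. Backwards from the block ends, the row arrives from its climb
    where the column is already descending, which kills the second entry. *)
Lemma block_lt i j : W i < W j ->
  X (offset i) (offset j) = 0%R /\ X (offset i.+1) (offset j.+1) = 0%R.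
Proof.
case: XP => _ _ X2 X3 ltW; split.
  rewrite (@run_up _ _ (W i).+1) //; last by lia.
  have := @Z_down i (W i) (leqnn _); have := @Z_up j (W i).+1 ltW.
  have -> : (W i).*2.+1 - W i = (W i).+1 by lia.
  by move=> e1 e2; apply: X2; rewrite e1 e2.
rewrite -(@run_down _ _ (W i).+1) //; last by lia.
have e1 := @Z_up i (W i) (leqnn _); have e2 := @Z_down j (W i).+1 ltW.
have -> : offset i + ((W i).+1.*2 - (W i).+1) = (offset i + W i).+1 by lia.
have -> : offset j + ((W j).+1.*2 - (W i).+1) =
          (offset j + ((W j).*2.+1 - (W i).+1)).+1 by lia.
by apply: X3; rewrite e1 e2.
Qed.

(** The two positions have the same height. If one climbs and the other descends, an adjacent
    mismatch kills the entry; otherwise they are equally far from the starts, or from the ends, of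
    their blocks. *)
Lemma reach_corner u s : X u s <> 0%R ->
  exists i j c, X u s = X (offset i) (offset j) /\
    (u = offset i + c /\ s = offset j + c \/
     u + c = offset i /\ s + c = offset j).
Proof.
case: XP => X0 _ X2 X3 Xn0.
have [i [p [ltp eu]]] := offset_decomp u.
have [j [q [ltq es]]] := offset_decomp s.
have Zu := Z_offset ltp; have Zs := Z_offset ltq; rewrite -eu -es in Zu Zs.
have eqv : code_vertex (Z u) = code_vertex (Z s).
  by apply/eqP; apply: contra_notT Xn0 => /eqP/X0.
rewrite Zu Zs !code_vertex_block // in eqv.
have [lep|ltWp] := leqP p (W i).+1.
  have [leq|ltWq] := leqP q (W j).+1.
    have epq : p = q by lia.
    by subst q; exists i, j, p; rewrite eu es -run_up //; split=> //; left.
  case: Xn0; rewrite eu es.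
  have -> : offset i + p = (offset i + p.-1).+1 by lia.
  have -> : offset j + q =
            (offset j + ((W j).*2.+1 - ((W j).*2.+1 - q.-1))).+1 by lia.
  by apply: X3; rewrite Z_up ?Z_down //; lia.
have [leq|ltWq] := leqP q (W j).
  case: Xn0; apply: X2; rewrite Zu Zs /block_code leq leqNgt.
    by rewrite (ltnW ltWp).
  by rewrite (ltnW ltWp).
exists i.+1, j.+1, ((W i).+1.*2 - p).
have epq : (W i).+1.*2 - p = (W j).+1.*2 - q.
  by lia.
split; last by right; rewrite {2}epq eu es !offsetS; lia.
rewrite -(@run_down _ _ ((W i).+1.*2 - p)); try lia.
by rewrite eu es {2}epq; congr X; lia.
Qed.

Variable r : nat.
Hypothesis r_gt0 : 0 < r.
Hypothesis W_mod : forall i j, i = j %[mod r] -> W i = W j.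
Hypothesis X_period : forall u s, X (u + offset r) (s + offset r) = X u s.
Hypothesis W_aligned :
  forall i j, (forall t, W (i + t) = W (j + t)) -> i = j %[mod r].

Lemma offsetD i : offset (i + r) = offset i + offset r.
Proof.
elim: i => [|i IH]; first by rewrite {2}/offset big_ord0.
by rewrite addSn !offsetS IH (W_mod (modnDr i r)) addnAC.
Qed.

Lemma offset_mod i j : i = j %[mod r] -> offset i = offset j %[mod offset r].
Proof.
have offM q m : offset (q * r + m) = offset m %[mod offset r].
  by elim: q => // q IH; rewrite mulSn -addnA addnC offsetD modnDr.
by rewrite {2}(divn_eq i r) {2}(divn_eq j r) !offM => ->.
Qed.

(** A nonzero entry propagates from its corner both ways up to the first differing blocks, and
    [block_lt] makes the row block the larger one at both ends. *)
Theorem diagonal_system_diag u s : ~ unclustered W ->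
  u <> s %[mod offset r] -> X u s = 0%R.
Proof.
move=> clW neq; apply/eqP; apply: contra_notT clW => /eqP Xn0.
have [i [j [c [eX eqc]]]] := reach_corner Xn0; rewrite eX in Xn0.
have neqij : i <> j %[mod r].
  move=> /offset_mod e; apply: neq.
  case: eqc => -[e1 e2]; first by rewrite e1 e2 -modnDml e modnDml.
  by apply/eqP; rewrite -(eqn_modDr c) e1 e2; apply/eqP.
have [t0 ltt0 neqt0] : exists2 t, t < r & W (i + t) != W (j + t).
  have [/existsP[t neqt]|/existsPn eqW] :=
      boolP [exists t : 'I_r, W (i + t) != W (j + t)]; first by exists t.
  case: neqij; apply: W_aligned => t.
  rewrite (@W_mod _ (i + t %% r)) ?modnDmr //.
  rewrite (@W_mod (j + t) (j + t %% r)) ?modnDmr //.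
  by apply/eqP; rewrite -[_ == _]negbK (eqW (Ordinal (ltn_pmod t r_gt0))).
clear neq neqij.
have [|m _ [eqm neqm]] := @first_mismatch _ (W \o addn i) (W \o addn j) r.
  by exists t0.
(* The backward search starts one period later, so that stepping back at most [r] blocks stays in
   nat; [X_period] compensates. *)
have [|m' ltm' [eqm' neqm']] := @first_mismatch _
    (fun t => W (i + r - t.+1)) (fun t => W (j + r - t.+1)) r.
  exists (r - t0.+1); first by lia.
  have -> : i + r - (r - t0.+1).+1 = i + t0 by lia.
  by have -> : j + r - (r - t0.+1).+1 = j + t0 by lia.
have {}eqm' t : t < m' -> W (i + r - m' + t) = W (j + r - m' + t).
  move=> ltt; have := eqm' (m' - t.+1).
  have -> : i + r - (m' - t.+1).+1 = i + r - m' + t by lia.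
  have -> : j + r - (m' - t.+1).+1 = j + r - m' + t by lia.
  by apply; lia.
have Xm : X (offset (i + m)) (offset (j + m)) <> 0%R by rewrite -block_run.
have Xm' : X (offset (i + r - m')) (offset (j + r - m')) <> 0%R.
  rewrite (@block_run _ _ m') //.
  have -> : i + r - m' + m' = i + r by lia.
  have -> : j + r - m' + m' = j + r by lia.
  by rewrite !offsetD X_period.
exists (i + r - m'.+1), (j + r - m'.+1), (m' + m).
have subS a : m' < a -> (a - m'.+1).+1 = a - m' by move=> lt; rewrite subnSK.
rewrite !subS; try lia.
split=> [|t ltt|]; rewrite ?ltEnat /=.
- rewrite ltn_neqAle eq_sym neqm' leqNgt; apply/negP => /block_lt[_].
  by rewrite !subS; try lia.
- have [/eqm'//|let'] := ltnP t m'.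
  have -> : i + r - m' + t = i + (t - m') + r by lia.
  have -> : j + r - m' + t = j + (t - m') + r by lia.
  by rewrite !(W_mod (modnDr _ r)); apply: eqm; lia.
have -> : i + r - m' + (m' + m) = i + m + r by lia.
have -> : j + r - m' + (m' + m) = j + m + r by lia.
rewrite !(W_mod (modnDr _ r)) ltn_neqAle eq_sym neqm leqNgt.
by apply/negP => /block_lt[].
Qed.

End Vanishing.

(** * Graph maps from unclustered words *)

Lemma Z_blocks i j l : (forall t, t < l -> W (i + t) = W (j + t)) ->
  exists c, [/\ offset (i + l) = offset i + c, offset (j + l) = offset j + c
    & forall t, t < c -> Z (offset i + t) = Z (offset j + t)].
Proof.
elim: l => [|l IH] H; first by exists 0; rewrite !addn0.
have [|c [ei ej eqZ]] := IH; first by move=> t /ltnW; apply: H.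
exists (c + (W (i + l)).+1.*2); rewrite [i + _]addnS [j + _]addnS.
rewrite !offsetS ei ej !addnA.
split=> // [|t ltt]; first by rewrite H.
have [/eqZ//|le] := ltnP t c.
rewrite -(subnKC le) !addnA -ei -ej !Z_offset -?H //; last by lia.
by rewrite ltn_subLR.
Qed.

(** The segment starts at the peak of block [j], when block [i] has come down to the same height. It
    follows the descent and the common blocks, and ends at the peak of the smaller of the two final
    blocks. *)
Lemma unclustered_graph_map : unclustered W ->
  exists a b m, [/\ (Z a).1 && ~~ (Z b).1,
    code_vertex (Z a.+1) = code_vertex (Z b.+1),
    forall t, t < m -> Z (a.+1 + t) = Z (b.+1 + t)
    & ~~ (Z (a.+1 + m)).1 && (Z (b.+1 + m)).1].
Proof.
case=> i [j [l [ltW0 /Z_blocks[c [ei ej eqZ]] ltWl]]].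
rewrite !ltEnat /= in ltW0 ltWl.
(* [a] is the descending letter of block [i] that ends at height [W j + 1]; [b] is the last climbing
   letter of block [j]. *)
pose a := offset i + ((W i).*2.+1 - (W j).+1); pose b := offset j + W j.
have aE t : a.+1 + ((W j).+1 + t) = offset i.+1 + t by rewrite offsetS /a; lia.
have bE t : b.+1 + ((W j).+1 + t) = offset j.+1 + t by rewrite offsetS /b; lia.
have eq1 t : t <= W j -> Z (a.+1 + t) = Z (b.+1 + t).
  move=> let'.
  have -> : a.+1 + t = offset i + ((W i).*2.+1 - (W j - t)) by rewrite /a; lia.
  have -> : b.+1 + t = offset j + ((W j).*2.+1 - (W j - t)) by rewrite /b; lia.
  by rewrite !Z_down //; lia.
exists a, b, ((W j).+1 + (c + (W (j.+1 + l)).+1)); split.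
- by rewrite Z_down ?Z_up.
- by have := eq1 0 isT; rewrite !addn0 => ->.
- move=> t ltt; have [/eq1//|lt] := leqP t (W j).
  rewrite -(subnKC lt) aE bE.
  have [/eqZ//|le] := ltnP (t - (W j).+1) c.
  by rewrite -(subnKC le) !addnA -ei -ej !Z_up //; lia.
rewrite aE bE !addnA -ei -ej Z_up //=.
have := @Z_down (j.+1 + l) (W (j.+1 + l)) (leqnn _).
by have -> : forall h, h.*2.+1 - h = h.+1 by [lia]; move=> ->.
Qed.

Section GraphMap.
Variables (S : pzSemiRingType) (R a b m : nat).
Hypothesis Z_mod : forall u s, u = s %[mod R] -> Z u = Z s.
Hypothesis start_ab : (Z a).1 && ~~ (Z b).1.
Hypothesis vertex_ab : code_vertex (Z a.+1) = code_vertex (Z b.+1).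
Hypothesis run_ab : forall t, t < m -> Z (a.+1 + t) = Z (b.+1 + t).
Hypothesis stop_ab : ~~ (Z (a.+1 + m)).1 && (Z (b.+1 + m)).1.
Hypothesis Z_walk :
  forall u s, Z u = Z s -> code_vertex (Z u.+1) = code_vertex (Z s.+1).

Definition on_segment u s : bool :=
  [exists t : 'I_m.+1, (u == a.+1 + t %[mod R]) && (s == b.+1 + t %[mod R])].

(** The map carrying the segment after [b], a factor substring, identically onto the segment after
    [a], a submodule substring. *)
Definition graph_map u s : S := (on_segment u s)%:R%R.

Lemma on_segmentP u s : reflect
  (exists2 t, t <= m & u = a.+1 + t %[mod R] /\ s = b.+1 + t %[mod R])
  (on_segment u s).
Proof.
apply: (iffP existsP) => [[t /andP[/eqP eu /eqP es]]|[t lt [/eqP eu /eqP es]]].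
  by exists t; rewrite // -ltnS.
by exists (Ordinal (lt : t < m.+1)); rewrite eu.
Qed.

(** Equal letters never lead into or out of the segment, since the letters at its ends differ; and
    those two mismatches are of the kind that forces no vanishing there. *)
Lemma graph_map_system : diagonal_system graph_map.
Proof.
have modS u v : u = v %[mod R] -> u.+1 = v.+1 %[mod R].
  by move=> e; rewrite -[u.+1]addn1 -[v.+1]addn1 -modnDml e modnDml.
have modSI u v : u.+1 = v.+1 %[mod R] -> u = v %[mod R].
  by move/eqP; rewrite -[u.+1]addn1 -[v.+1]addn1 eqn_modDr => /eqP.
have off b' : ~~ b' -> (b' : bool)%:R%R = 0%R :> S by move/negPf->.
rewrite /graph_map; split=> u s.
- move=> neqv; apply/off; apply/on_segmentP => -[t lt [/Z_mod eu /Z_mod es]].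
  apply: neqv; rewrite eu es; case: t lt {eu es} => [|t] lt.
    by rewrite !addn0.
  by rewrite !addnS; apply/Z_walk/run_ab.
- move=> eqZ; suff -> : on_segment u s = on_segment u.+1 s.+1 by [].
  apply/on_segmentP/on_segmentP => -[t lt [eu es]].
    exists t.+1; last by rewrite !addnS; split; apply: modS.
    rewrite ltn_neqAle lt andbT; apply/eqP => em; subst t.
    by move: stop_ab; rewrite -(Z_mod eu) -(Z_mod es) eqZ; case: (Z s).1.
  case: t lt eu es => [|t] lt; rewrite ?addn0 ?addnS => /modSI eu /modSI es.
    by move: start_ab; rewrite -(Z_mod eu) -(Z_mod es) eqZ; case: (Z s).1.
  by exists t; first exact: ltnW.
- move=> neqZ; apply: contraTeq => /= h; have: on_segment u s.
    by apply: contraNT h => /off->.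
  case/on_segmentP=> t lt [/Z_mod eu /Z_mod es]; rewrite eu es.
  have [/run_ab eqZ|] := ltnP t m; first by case: neqZ; rewrite eu es.
  rewrite leq_eqVlt ltnNge lt orbF => /eqP<-.
  by rewrite negb_or negbK.
move=> neqZ; apply: contraTeq => /= h; have: on_segment u.+1 s.+1.
  by apply: contraNT h => /off->.
case/on_segmentP=> [[|t] lt []]; rewrite ?addn0 ?addnS;
  move=> /modSI/Z_mod eu /modSI/Z_mod es.
  by rewrite eu es negb_or negbK.
by case: neqZ; rewrite eu es; apply: run_ab.
Qed.

End GraphMap.
End Diagonals.

(** * Endomorphisms of band modules *)

Section BandEndomorphisms.
Variables (k : fieldType) (Q : bound_quiver) (z : seq (letter Q)) (lambda : k).
Hypothesis hz : band_walk z.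
Hypothesis lambda0 : lambda != 0.
Hypothesis oriented : forall a, (direct a \notin z) || (inverse a \notin z).

Local Notation r := (size z).
Local Notation gam := (tnth (in_tuple z)).
Local Notation M := (band_module lambda hz).
Implicit Types (s t u : 'I_r) (a : arrow Q) (v : vertex Q).

Definition is_direct (g : letter Q) : bool :=
  if g is inl _ then true else false.

Lemma band_vertexS s : band_vertex (ordS s) = ltgt (gam s).
Proof.
case: hz => _ _ _ /(_ 2%N); rewrite /power /= cats0 => /andP[+ _].
have g0 : letter Q := gam s.
move/(sortedP g0)/(_ (s : nat)); rewrite size_cat.
have -> : (s.+1 < r + r)%N by have := ltn_ord s; lia.
move=> /(_ isT)/eqP; rewrite !nth_cat ltn_ord /band_vertex !(tnth_nth g0) /=.
move=> ->; have := ltn_ord s; rewrite leq_eqVlt => /predU1P[eqSr|ltSr].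
  by rewrite eqSr ltnn subnn modnn.
by rewrite ltSr modn_small.
Qed.

Definition wrap s : k := if s.+1 == r then lambda else 1.

Lemma wrap_neq0 s : wrap s != 0.
Proof. by rewrite /wrap; case: ifP => // _; rewrite oner_neq0. Qed.

Lemma band_coef_direct a s t : inverse a \notin z ->
  band_coef lambda a s t = ((gam s == direct a)%:R * wrap s) *+ (t == ordS s).
Proof.
move=> nz; rewrite /band_coef -/(wrap s).
case: eqP => _; first by rewrite mul1r.
rewrite mul0r mul0rn ifN //; apply: contraNN nz => /eqP <-.
exact: mem_tnth.
Qed.

Lemma band_coef_inverse a s t : direct a \notin z ->
  band_coef lambda a s t =
    ((gam (ord_pred s) == inverse a)%:R / wrap (ord_pred s))
      *+ (t == ord_pred s).
Proof.
move=> nz; rewrite /band_coef ifN; last first.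
  by apply: contraNN nz => /eqP <-; exact: mem_tnth.
have -> : (if s == 0%N :> nat then lambda^-1 else 1) = (wrap (ord_pred s))^-1.
  rewrite /wrap -[in LHS](ord_predK s) /=; set p := ord_pred s.
  have := ltn_ord p; rewrite leq_eqVlt => /predU1P[->|lt].
    by rewrite modnn !eqxx.
  by rewrite modn_small // (ltn_eqF lt) /= invr1.
by case: eqP => _; rewrite ?mul1r ?mul0r ?mul0rn.
Qed.

Definition commutes (phi : 'I_r -> 'I_r -> k) : Prop :=
  forall a s t, band_vertex s = src a -> band_vertex t = tgt a ->
  \sum_t' band_coef lambda a s t' * phi t t' =
  \sum_s' phi s' s * band_coef lambda a s' t.

Definition vertex_diag (phi : 'I_r -> 'I_r -> k) : Prop :=
  forall u s, band_vertex u <> band_vertex s -> phi u s = 0.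

(** What remains of [commutes] once each sum has a single term; the vanishing clauses are the
    mismatches for which one side of an equation is zero. *)
Definition band_system (phi : 'I_r -> 'I_r -> k) : Prop :=
  [/\ forall u s, gam u = gam s ->
        wrap u * phi u s = wrap s * phi (ordS u) (ordS s),
      forall u s, gam u <> gam s -> is_direct (gam u) || ~~ is_direct (gam s) ->
        phi u s = 0
    & forall u s, gam u <> gam s -> ~~ is_direct (gam u) || is_direct (gam s) ->
        phi (ordS u) (ordS s) = 0].

Lemma commutes_direct phi a u s : inverse a \notin z ->
  (\sum_t' band_coef lambda a s t' * phi (ordS u) t' =
   \sum_s' phi s' s * band_coef lambda a s' (ordS u)) <->
  ((gam s == direct a)%:R * wrap s * phi (ordS u) (ordS s) =
   (gam u == direct a)%:R * wrap u * phi u s).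
Proof.
move=> nz; rewrite (bigD1 (ordS s)) //= big1 => [|t /negPf neq]; last first.
  by rewrite band_coef_direct // neq mul0r.
rewrite (bigD1 u) //= big1 => [|t neq]; last first.
  rewrite band_coef_direct // (inj_eq (can_inj (@ordSK _))).
  by rewrite [u == t]eq_sym (negPf neq) mulr0.
by rewrite !addr0 !band_coef_direct // !eqxx !mulr1n (mulrC (phi u s)).
Qed.

Lemma commutes_inverse phi a u s : direct a \notin z ->
  (\sum_t' band_coef lambda a (ordS s) t' * phi u t' =
   \sum_s' phi s' (ordS s) * band_coef lambda a s' u) <->
  ((gam s == inverse a)%:R / wrap s * phi u s =
   (gam u == inverse a)%:R / wrap u * phi (ordS u) (ordS s)).
Proof.
move=> nz; rewrite (bigD1 s) //= big1 => [|t /negPf neq]; last first.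
  by rewrite band_coef_inverse // ordSK neq mul0r.
rewrite (bigD1 (ordS u)) //= big1 => [|t neq]; last first.
  have /negPf neq' : u != ord_pred t.
    by apply: contraNneq neq => ->; rewrite ord_predK.
  by rewrite band_coef_inverse // neq' mulr0.
rewrite !addr0 !band_coef_inverse // !ordSK !eqxx !mulr1n.
by rewrite (mulrC (phi _ (ordS s))).
Qed.

Lemma direct_notin a s : gam s = direct a -> inverse a \notin z.
Proof.
by move=> e; case/orP: (oriented a) => //; rewrite -e mem_tnth.
Qed.

Lemma inverse_notin a s : gam s = inverse a -> direct a \notin z.
Proof.
by move=> e; case/orP: (oriented a) => //; rewrite -e mem_tnth.
Qed.

(** An equation is available only where the vertices fit the arrow; [vertex_diag] covers the other
    mismatches. *)
Lemma commutes_system phi : vertex_diag phi -> commutes phi -> band_system phi.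
Proof.
move=> diag comm.
have cd a u s : inverse a \notin z ->
    band_vertex s = src a -> band_vertex (ordS u) = tgt a ->
    (gam s == direct a)%:R * wrap s * phi (ordS u) (ordS s) =
    (gam u == direct a)%:R * wrap u * phi u s.
  by move=> nz es eu; apply/(commutes_direct _ _ _ nz)/comm.
have ci a u s : direct a \notin z ->
    band_vertex (ordS s) = src a -> band_vertex u = tgt a ->
    (gam s == inverse a)%:R / wrap s * phi u s =
    (gam u == inverse a)%:R / wrap u * phi (ordS u) (ordS s).
  by move=> nz es eu; apply/(commutes_inverse _ _ _ nz)/comm.
split=> u s.
- case es: (gam s) => [a|a] eu.
    have := cd a u s (direct_notin es).
    rewrite !band_vertexS /band_vertex es eu !eqxx !mul1r => -> //.
  have := ci a u s (inverse_notin es).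
  rewrite !band_vertexS /band_vertex es eu !eqxx !mul1r => /(_ erefl erefl) e.
  rewrite -(mulVKf (wrap_neq0 s) (phi u s)) e mulrCA mulVKf //.
  exact: wrap_neq0.
- have [eqv|/eqP/diag//] := eqVneq (band_vertex u) (band_vertex s).
  case eu: (gam u) => [a|a] neq.
    have ns : (gam s == direct a) = false by apply/eqP => es; case: neq.
    have := cd a u s (direct_notin eu).
    rewrite band_vertexS -eqv /band_vertex eu eqxx ns !mul0r mul1r.
    move=> /(_ erefl erefl)/esym/eqP.
    by rewrite mulf_eq0 (negPf (wrap_neq0 u)) => /eqP.
  case es: (gam s) neq => [//|b] neq _.
  have nu : (gam u == inverse b) = false by rewrite eu; apply/eqP.
  have := ci b u s (inverse_notin es).
  rewrite band_vertexS eqv /band_vertex es eqxx nu !mul0r mul1r.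
  move=> /(_ erefl erefl)/eqP.
  by rewrite mulf_eq0 invr_eq0 (negPf (wrap_neq0 s)) => /eqP.
have [eqv|/eqP/diag//] := eqVneq (band_vertex (ordS u)) (band_vertex (ordS s)).
case es: (gam s) => [a|a] neq.
  have nu : (gam u == direct a) = false by apply/eqP => eu; case: neq.
  have := cd a u s (direct_notin es).
  rewrite eqv band_vertexS /band_vertex es eqxx nu !mul0r mul1r.
  move=> /(_ erefl erefl)/eqP.
  by rewrite mulf_eq0 (negPf (wrap_neq0 s)) => /eqP.
case eu: (gam u) neq => [//|b] neq _.
have ns : (gam s == inverse b) = false by rewrite es; apply/eqP => /esym.
have := ci b u s (inverse_notin eu).
rewrite -eqv band_vertexS /band_vertex eu eqxx ns !mul0r mul1r.
move=> /(_ erefl erefl)/esym/eqP.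
by rewrite mulf_eq0 invr_eq0 (negPf (wrap_neq0 u)) => /eqP.
Qed.

Lemma system_commutes phi : band_system phi -> commutes phi.
Proof.
case=> eq1 eq2 eq3 a s t es et.
have [nz|nz] := orP (oriented a).
  rewrite -(ord_predK s); set s' := ord_pred s.
  apply/(commutes_inverse _ _ _ nz).
  have [gs|ngs] := eqVneq (gam s') (inverse a);
    have [gt|ngt] := eqVneq (gam t) (inverse a); rewrite ?mul0r //.
  - have := eq1 t s'; rewrite gs gt => /(_ erefl) e.
    rewrite !mul1r; apply: (mulfI (wrap_neq0 s')); rewrite mulVKf ?wrap_neq0 //.
    by rewrite mulrCA -e mulKf ?wrap_neq0.
  - by rewrite eq2 ?mulr0 ?gs ?orbT //; apply/eqP.
  by rewrite eq3 ?mulr0 ?gt //; apply/eqP; rewrite eq_sym.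
rewrite -(ord_predK t); set t' := ord_pred t.
apply/(commutes_direct _ _ _ nz).
have [gs|ngs] := eqVneq (gam s) (direct a);
  have [gt|ngt] := eqVneq (gam t') (direct a); rewrite ?mul0r //.
- by have := eq1 t' s; rewrite gs gt => /(_ erefl) e; rewrite !mul1r e.
- by rewrite eq3 ?mulr0 ?gs ?orbT //; apply/eqP.
by rewrite eq2 ?mulr0 ?gt //; apply/eqP; rewrite eq_sym.
Qed.

Local Notation space v := (@band_space k Q z v).
Implicit Type f : forall v, 'End(space v).

Definition unit_vector v s : space v := [ffun t => (val t == s)%:R].

(** Extending by zero to positions at different vertices gives an ordinary matrix, free of dependent
    indices. *)
Definition endo_coef f u s : k :=
  if insub u is Some t then
    (f (band_vertex s) (unit_vector (band_vertex s) s)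
       : {ffun {t | band_vertex t == band_vertex s} -> k^o}) t
  else 0.

Lemma endo_coefE f v (t s : {s : 'I_r | band_vertex s == v}) :
  (f v (unit_vector v (val s)) : space v) t =
    endo_coef f (val t) (val s).
Proof.
case: s => s es; move: (es) t => /eqP/= ev; case: v / ev es => es t.
by rewrite /endo_coef /= valK.
Qed.

Lemma endo_expand f v (x : space v) (t : {s : 'I_r | band_vertex s == v}) :
  (f v x : space v) t = \sum_s x s * endo_coef f (val t) (val s).
Proof.
have {1}-> : x = \sum_s x s *: unit_vector v (val s).
  apply/ffunP=> s; rewrite sum_ffunE (bigD1 s) //= big1 => [|s' neq].
    by rewrite addr0 !ffunE eqxx /GRing.scale /= mulr1.
  by rewrite !ffunE (inj_eq val_inj) eq_sym (negPf neq) scaler0.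
rewrite linear_sum sum_ffunE; apply: eq_bigr => s _.
by rewrite linearZ ffunE endo_coefE.
Qed.

Lemma endo_coef_diag f : vertex_diag (endo_coef f).
Proof. by move=> u s neq; rewrite /endo_coef insubF //; apply/eqP. Qed.

Lemma sum_vertex v (F : 'I_r -> k) :
  (forall t, band_vertex t <> v -> F t = 0) ->
  \sum_(t : {t : 'I_r | band_vertex t == v}) F (val t) = \sum_t F t.
Proof.
move=> F0; rewrite [RHS](bigID (fun t => band_vertex t == v)) /=.
rewrite [X in _ + X]big1 ?addr0 => [|t /eqP/F0//].
exact: esym (big_sub (fun t => band_vertex t == v) F).
Qed.

Lemma sum_unit_vector v s (G : 'I_r -> k) : band_vertex s = v ->
  \sum_(t : {t : 'I_r | band_vertex t == v})
     unit_vector v s t * G (val t) = G s.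
Proof.
move=> es; have /eqP es' := es; rewrite (bigD1 (Sub s es')) //= big1 => [|t].
  by rewrite ffunE eqxx mul1r addr0.
by rewrite -(inj_eq val_inj) ffunE => /negPf/= ->; rewrite mul0r.
Qed.

Lemma is_endo_commutes f : is_endo (M := M) f -> commutes (endo_coef f).
Proof.
move=> endo a s t es et; have /eqP es' := es; have /eqP et' := et.
have /(congr1 (fun g : 'Hom(_, _) => g (unit_vector (src a) s))) := endo a.
rewrite !comp_lfunE /= !band_mapE.
move/(congr1 (fun g : space (tgt a) => g (Sub t et'))).
have diag := @endo_coef_diag f.
rewrite endo_expand ffunE /= => e; apply: etrans (etrans _ e) _.
  rewrite -(@sum_vertex (tgt a)) => [|t' neq].
    apply: eq_bigr => t' _; rewrite ffunE.
    by rewrite (@sum_unit_vector _ s (band_coef lambda a ^~ (val t'))).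
  by rewrite diag ?mulr0 // et => /esym.
rewrite -[RHS](@sum_vertex (src a)) => [|s' neq]; last first.
  by rewrite diag ?mul0r // es.
apply: eq_bigr => s' _; rewrite endo_expand.
by rewrite (@sum_unit_vector _ s (endo_coef f (val s'))).
Qed.

Definition coef_lfun (phi : 'I_r -> 'I_r -> k) v : 'End(space v) :=
  linfun (fun x : space v =>
    [ffun t => \sum_s x s * phi (val t) (val s)] : space v).

Lemma coef_lfunE phi v (x : space v) (t : {s : 'I_r | band_vertex s == v}) :
  (coef_lfun phi v x : space v) t = \sum_s x s * phi (val t) (val s).
Proof.
pose g (x : space v) : space v := [ffun t => \sum_s x s * phi (val t) (val s)].
have lin_g : linear g.
  move=> c y y'; apply/ffunP=> u; rewrite !ffunE /GRing.scale /= mulr_sumr.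
  rewrite -big_split; apply: eq_bigr => s _ /=.
  by rewrite !ffunE mulrDl mulrA.
pose gL := GRing.isLinear.Build _ _ _ _ g lin_g.
pose g' : {linear space v -> space v} := HB.pack g gL.
by rewrite /coef_lfun -/g (lfunE g') ffunE.
Qed.

Lemma is_endo_coef_lfun phi :
  vertex_diag phi -> commutes phi -> is_endo (M := M) (coef_lfun phi).
Proof.
move=> diag comm a; apply/lfunP => x; rewrite !comp_lfunE /= !band_mapE.
apply/(@ffunP _ (fun=> k)) => t; rewrite coef_lfunE [RHS]ffunE.
transitivity (\sum_(s : {s : 'I_r | band_vertex s == src a})
    x s * \sum_t' band_coef lambda a (val s) t' * phi (val t) t').
  under eq_bigr do rewrite ffunE mulr_suml.
  rewrite exchange_big; apply: eq_bigr => s _ /=.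
  rewrite -(@sum_vertex (tgt a)) => [|t' neq].
    by rewrite mulr_sumr; apply: eq_bigr => t' _; rewrite mulrA.
  by rewrite diag ?mulr0 // (eqP (valP t)) => /esym.
under [RHS]eq_bigr do rewrite coef_lfunE mulr_suml.
rewrite [RHS]exchange_big; apply: eq_bigr => s _ /=.
rewrite comm ?(eqP (valP s)) ?(eqP (valP t)) //.
rewrite -(@sum_vertex (src a)) => [|t' neq].
  by rewrite mulr_sumr; apply: eq_bigr => t' _; rewrite mulrA.
by rewrite diag ?mul0r // (eqP (valP s)).
Qed.

(** * Independence of lambda *)

Definition untwisted_system (chi : 'I_r -> 'I_r -> k) : Prop :=
  [/\ vertex_diag chi,
      forall u s, gam u = gam s -> chi u s = chi (ordS u) (ordS s),
      forall u s, gam u <> gam s -> is_direct (gam u) || ~~ is_direct (gam s) ->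
        chi u s = 0
    & forall u s, gam u <> gam s -> ~~ is_direct (gam u) || is_direct (gam s) ->
        chi (ordS u) (ordS s) = 0].

(* Moving the factor lambda of the last letter onto the entries above the     *)
(* diagonal makes the equations independent of lambda.                        *)
Definition twist u s : k := if (u < s)%N then lambda else 1.

Lemma twist_neq0 u s : twist u s != 0.
Proof. by rewrite /twist; case: ifP => // _; rewrite oner_neq0. Qed.

(** The cyclic successor changes the order of [u] and [s] exactly when one of them alone is the last
    position; the [lambda] that [twist] gains or loses then balances the one in [wrap]. *)
Lemma wrap_twist u s :
  wrap u * twist u s = wrap s * twist (ordS u) (ordS s).
Proof.
rewrite /wrap /twist /=; have ltu := ltn_ord u; have lts := ltn_ord s.
have [eu|neu] := eqVneq u.+1 r; have [es|nes] := eqVneq s.+1 r.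
- have -> : val u = val s by apply: succn_inj; rewrite eu es.
  by rewrite ltnn es modnn.
- rewrite eu modnn modn_small ?ltnS; last by lia.
  by rewrite ifN ?mulr1 ?mul1r //; lia.
- rewrite es modnn modn_small ?ltnS; last by lia.
  by rewrite ifT ?mulr1 ?mul1r //; lia.
by rewrite !modn_small //; lia.
Qed.

Lemma brick_untwisted chi u s : brick M -> untwisted_system chi -> u != s ->
  chi u s = 0.
Proof.
case=> _ scal [diag eq1 eq2 eq3] neq.
pose phi u s := twist u s * chi u s.
have dphi : vertex_diag phi.
  by move=> u' s' /diag; rewrite /phi => ->; rewrite mulr0.
have sphi : band_system phi.
  split=> u' s' h; rewrite /phi.
  - by rewrite !mulrA wrap_twist eq1.
  - by move=> h'; rewrite eq2 ?mulr0.
  by move=> h'; rewrite eq3 ?mulr0.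
have [eqv|/eqP/diag//] := eqVneq (band_vertex u) (band_vertex s).
have [c fc] := scal _ (is_endo_coef_lfun dphi (system_commutes sphi)).
have eu : band_vertex u == band_vertex s by apply/eqP.
have /(congr1 (fun g : 'Hom(_, _) => g (unit_vector (band_vertex s) s))) :=
  fc (band_vertex s).
move/(congr1 (fun g : space _ => g (Sub u eu))).
rewrite coef_lfunE sum_unit_vector //= => /eqP.
rewrite scale_lfunE id_lfunE !ffunE /= (negPf neq) scaler0 mulf_eq0.
by rewrite (negPf (twist_neq0 u s)) => /eqP.
Qed.

(** Every letter equals itself, so untwisted entries are constant along the main diagonal; without
    off-diagonal entries the endomorphism is scalar. *)
Lemma untwisted_brick :
  (forall chi, untwisted_system chi -> forall u s, u != s -> chi u s = 0) ->
  brick M.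
Proof.
move=> H; have r0 : (0 < r)%N by case: hz => _ _ [+ _] _; case: (z).
pose s0 := Ordinal r0; split.
  have ev0 : band_vertex s0 == band_vertex s0 by [].
  exists (band_vertex s0) => /eqP; rewrite dimv_eq0 => /eqP e.
  have : unit_vector (band_vertex s0) s0 \in fullv by rewrite memvf.
  rewrite e memv0 => /eqP/(congr1 (fun g : space (band_vertex s0) =>
    g (Sub s0 ev0))).
  by rewrite !ffunE eqxx => /eqP; rewrite oner_eq0.
move=> f endo; pose phi := endo_coef f; pose chi u s := phi u s / twist u s.
have diag : vertex_diag phi := @endo_coef_diag f.
have [eq1 eq2 eq3] := commutes_system diag (is_endo_commutes endo).
have sys : untwisted_system chi.
  split=> u s; rewrite /chi.
  - by move=> /diag ->; rewrite mul0r.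
  - move=> /eq1; rewrite -/phi => e.
    apply/eqP; rewrite eqr_div ?twist_neq0 //; apply/eqP.
    apply: (mulfI (wrap_neq0 s)); rewrite mulrCA -wrap_twist mulrCA mulrA e.
    by rewrite mulrA.
  - by move=> h /(eq2 _ _ h) ->; rewrite mul0r.
  by move=> h /(eq3 _ _ h) ->; rewrite mul0r.
have chi_diag u : chi u u = chi s0 s0.
  case: sys => _ eqS _ _; case: u; elim=> [|m IH] ltm.
    by congr chi; apply: val_inj.
  have ltm' := ltnW ltm; rewrite -(IH ltm') (eqS (Ordinal ltm')) //.
  by congr chi; apply: val_inj; rewrite /= modn_small.
have phiE u s : phi u s = chi s0 s0 *+ (u == s).
  have [->|neq] := eqVneq u s.
    by rewrite -(chi_diag s) /chi /twist ltnn divr1.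
  by have /eqP := H _ sys _ _ neq; rewrite mulf_eq0 invr_eq0
    (negPf (twist_neq0 u s)) orbF => /eqP.
exists (chi s0 s0) => v; apply/lfunP=> x; apply/(@ffunP _ (fun=> k)) => t.
rewrite endo_expand scale_lfunE id_lfunE ffunE (bigD1 t) //= big1 => [|s neq].
  by rewrite -/phi phiE eqxx addr0 mulrC.
by rewrite -/phi phiE (inj_eq val_inj) eq_sym (negPf neq) mulr0.
Qed.

End BandEndomorphisms.

(** * The band psi(w) *)

Section Blocks.
Local Open Scope nat_scope.
Implicit Types (h p j N : nat) (ws : seq nat).

Definition block h : seq (bool * nat) :=
  [seq (false, p) | p <- iota 0 h.+1] ++ rev [seq (true, p) | p <- iota 0 h.+1].

Lemma size_block h : size (block h) = h.+1.*2.
Proof. by rewrite size_cat size_rev !size_map !size_iota addnn. Qed.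

Lemma nth_block c0 h p : p < h.+1.*2 -> nth c0 (block h) p = block_code h p.
Proof.
move=> ltp; rewrite nth_cat size_map size_iota /block_code ltnS.
case: leqP => [le|lt]; first by rewrite (nth_map 0) ?size_iota // nth_iota.
rewrite nth_rev size_map size_iota; last by lia.
by rewrite (nth_map 0) ?size_iota ?nth_iota; [congr pair|..]; lia.
Qed.

Lemma size_flatten_block W N :
  size (flatten [seq block h | h <- mkseq W N]) = offset W N.
Proof.
elim: N => [|N IH]; first by rewrite /offset big_ord0.
by rewrite mkseqS map_rcons flatten_rcons size_cat IH size_block offsetS.
Qed.

Lemma nth_flatten_block c0 W N j p : j < N -> p < (W j).+1.*2 ->
  nth c0 (flatten [seq block h | h <- mkseq W N]) (offset W j + p) =
  block_code (W j) p.
Proof.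
move=> + ltp; elim: N => // N IH; rewrite ltnS leq_eqVlt.
rewrite mkseqS map_rcons flatten_rcons nth_cat size_flatten_block.
case/predU1P=> [<-|ltj]; first by rewrite ltnNge leq_addr addKn nth_block.
have le := leq_offset W ltj.
by rewrite ifT ?IH // (leq_trans _ le) // offsetS ltn_add2l.
Qed.

Lemma cyc_flatten_block c0 ws j p : 0 < size ws ->
  p < (cyc 0 ws j).+1.*2 ->
  cyc c0 (flatten [seq block h | h <- ws]) (offset (cyc 0 ws) j + p) =
  block_code (cyc 0 ws j) p.
Proof.
move=> ws0 ltp; have le : j < j.+1 * size ws.
  by rewrite (leq_trans (ltnSn j)) ?leq_pmulr.
have eqP : flatten [seq block h | h <- mkseq (cyc 0 ws) (j.+1 * size ws)] =
           power j.+1 (flatten [seq block h | h <- ws]).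
  rewrite mkseq_cyc; elim: {le ltp} j.+1 => // m IH.
  by rewrite /power /= map_cat flatten_cat -/(power m ws) IH.
rewrite -(nth_flatten_block c0 le ltp) eqP nth_power //.
rewrite -size_power -eqP size_flatten_block.
by rewrite (leq_trans _ (leq_offset _ le)) // offsetS ltn_add2l.
Qed.

Lemma size_flatten_blocks ws :
  size (flatten [seq block h | h <- ws]) = offset (cyc 0 ws) (size ws).
Proof.
by rewrite -[size ws]mul1n -size_flatten_block mkseq_cyc /power /= cats0.
Qed.

End Blocks.

(** * Coding psi(w), and its primitivity *)

Section Psi.
Variable n : nat.
Implicit Types (w : seq 'I_n.-1) (g : letter (Qn n)).

Definition code g : bool * nat :=
  match g with inl a => (true, val a.1) | inr a => (false, val a.1) end.

(** With alphas direct and betas inverse, direction determines colour, so [code] loses nothing. *)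
Definition well_coloured g : bool :=
  match g with inl a => ~~ a.2 | inr a => a.2 end.

Lemma code_inj : {in well_coloured &, injective code}.
Proof.
by move=> [[a []]|[a []]] [[b []]|[b []]] // _ _ [/val_inj ->].
Qed.

Lemma psiE w : psi w = flatten [seq rev (zword i) | i <- rev w].
Proof. by rewrite /psi rev_flatten -map_comp map_rev. Qed.

Lemma rev_zword (i : 'I_n.-1) : rev (zword i) =
  [seq inverse (beta j) | j : 'I_n.-1 <- enum 'I_n.-1 & (j <= i)%N] ++
  rev [seq direct (alpha j) | j : 'I_n.-1 <- enum 'I_n.-1 & (j <= i)%N].
Proof. by rewrite /zword rev_cat revK. Qed.

Lemma val_enum_leq (i : 'I_n.-1) :
  [seq val j | j <- enum 'I_n.-1 & (val j <= i)%N] = iota 0 i.+1.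
Proof.
by rewrite -(filter_iota_leq 0 (ltn_ord i)) -val_enum_ord filter_map.
Qed.

Lemma code_psi w :
  map code (psi w) = flatten [seq block h | h <- map val (rev w)].
Proof.
rewrite psiE map_flatten -!map_comp; congr flatten; apply: eq_map => i /=.
have e := val_enum_leq i.
by rewrite rev_zword map_cat map_rev -!map_comp /block -e -!map_comp.
Qed.

Lemma well_coloured_psi w : {subset psi w <= well_coloured}.
Proof.
move=> g; rewrite psiE => /flattenP[_ /mapP[i _ ->]].
by rewrite rev_zword mem_cat mem_rev => /orP[] /mapP[j _ ->].
Qed.

Lemma oriented_psi w a : (direct a \notin psi w) || (inverse a \notin psi w).
Proof.
case: a => i b; case: b; apply/orP; [left|right]; apply/negP.
  by move/well_coloured_psi.
by move/well_coloured_psi.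
Qed.

(* Reading off the peaks inverts psi up to reversal, so that a decomposition  *)
(* of psi(w) as a power descends to w.                                        *)
Fixpoint peaks (z : seq (letter (Qn n))) : seq 'I_n.-1 :=
  if z is g :: z' then
    match g, z' with inr _, inl a :: _ => [:: a.1] | _, _ => [::] end
      ++ peaks z'
  else [::].

(** Excludes a spurious peak at the junction when this walk is appended to another. *)
Definition rises (z : seq (letter (Qn n))) : bool :=
  if z is inl _ :: _ then false else true.

Lemma peaks_cat u v : rises v -> peaks (u ++ v) = peaks u ++ peaks v.
Proof.
move=> upv; elim: u => //= g u IH; rewrite IH catA; congr ((_ ++ _) ++ _).
by case: g u {IH} => a [|[b|b] u] //=; case: v upv => [|[]].
Qed.

Lemma rises_psi w : rises (psi w).
Proof.
have := code_psi w; case: (psi w) => [|[a|a] z] //.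
by case: (rev w).
Qed.

Lemma peaks_power m u : rises u -> peaks (power m u) = power m (peaks u).
Proof.
move=> upu; elim: m => // m IH; rewrite /power /= -/(power m u).
rewrite peaks_cat ?IH //; case: m {IH} => // m; rewrite /power /=.
by case: u upu => [|[]] //= _; elim: m.
Qed.

Lemma peaks_rev_zword (i : 'I_n.-1) : peaks (rev (zword i)) = [:: i].
Proof.
have up s : peaks [seq inverse (beta j) | j : 'I_n.-1 <- s] = [::].
  by elim: s => //= j [].
have down s : peaks [seq direct (alpha j) | j : 'I_n.-1 <- s] = [::].
  by elim: s.
have := val_enum_leq i; rewrite rev_zword.
case/lastP: [seq j <- enum 'I_n.-1 | (val j <= i)%N] => // s j.
rewrite map_rcons -addn1 iotaD cats1 => /rcons_inj[_ /val_inj ->].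
by rewrite !map_rcons rev_rcons cat_rcons peaks_cat //= up -map_rev down.
Qed.

Lemma peaks_psi w : peaks (psi w) = rev w.
Proof.
rewrite psiE; elim: (rev w) => //= i v IH.
rewrite peaks_cat ?peaks_rev_zword ?IH //.
by have := rises_psi (rev v); rewrite psiE revK.
Qed.

Lemma primitive_psi w : primitive w -> primitive (psi w).
Proof.
move=> prim; have [w0 primw] := primitive_rev prim; split=> [e|u m lem e].
  by apply: w0; rewrite -peaks_psi e.
have upu : rises u.
  by have := rises_psi w; rewrite e; case: (m) lem => //= m' _; case: (u).
by apply: (primw (peaks u) m lem); rewrite -peaks_power // -e peaks_psi.
Qed.

End Psi.

(** * The band walk psi(w) and its brick criterion *)

Section PsiBand.
Variables (n : nat) (w : seq 'I_n.-1).
Hypothesis prim : primitive w.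

Local Notation z := (psi w).
Local Notation R := (size z).
Let W : nat -> nat := cyc 0%N [seq val i | i <- rev w].
Let Z : nat -> bool * nat := cyc (false, 0%N) [seq code g | g <- z].

Lemma size_w : (0 < size w)%N.
Proof. by case: prim; case: (w). Qed.

Lemma Z_psi j p : (p < (W j).+1.*2)%N ->
  Z (offset W j + p) = block_code (W j) p.
Proof.
rewrite /Z code_psi; apply: cyc_flatten_block.
by rewrite size_map size_rev size_w.
Qed.

Lemma size_psi : R = offset W (size w).
Proof.
by rewrite -(size_map (@code n)) code_psi size_flatten_blocks size_map size_rev.
Qed.

Lemma size_psi_gt0 : (0 < R)%N.
Proof.
by rewrite size_psi -(prednK size_w) offsetS; lia.
Qed.

Lemma Z_mod u s : u = s %[mod R] -> Z u = Z s.
Proof. by move=> e; apply: cyc_eqmod; rewrite size_map. Qed.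

Lemma code_cyc g0 u : code (cyc g0 z u) = Z u.
Proof.
rewrite /Z /cyc size_map (nth_map g0) //; apply: ltn_pmod; exact: size_psi_gt0.
Qed.

Lemma cyc_psi_coloured g0 u : well_coloured (cyc g0 z u).
Proof.
by apply: (@well_coloured_psi _ w); rewrite mem_nth // ltn_pmod // size_psi_gt0.
Qed.

Lemma val_lsrc (g : letter (Qn n)) : val (lsrc g) = code_vertex (code g).
Proof. by case: g => a /=; rewrite /code_vertex. Qed.

Lemma val_ltgt (g : letter (Qn n)) :
  val (ltgt g) = ((code g).2 + ~~ (code g).1)%N.
Proof. by case: g => a /=; rewrite ?addn0 ?addn1. Qed.

Lemma cyc_psi_walk g0 u : ltgt (cyc g0 z u) = lsrc (cyc g0 z u.+1).
Proof.
by apply: val_inj; rewrite val_ltgt val_lsrc !code_cyc (Z_adjacent Z_psi).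
Qed.

(** A relation needs two colours in one direction and a backtrack one colour in two directions;
    tying colour to direction excludes both. *)
Lemma well_coloured_string (g h : letter (Qn n)) :
  well_coloured g -> well_coloured h -> (h != linv g) && ~~ lzrel h g.
Proof.
case: g h => [[a []]|[a []]] [[b []]|[b []]] //= _ _;
  rewrite ?/Qn_zrel /= ?andbF ?andbT //;
  by apply/eqP; case.
Qed.

Lemma power_psi_string m : string_walk (power m z).
Proof.
case: m => // m; have g0 : letter (Qn n).
  by case: (z) size_psi_gt0 => // g.
have sz : size (power m.+1 z) = (m.+1 * R)%N by apply: size_power.
apply/andP; split; apply/(sortedP g0) => u; rewrite sz => lt.
  by rewrite !(nth_power g0) ?cyc_psi_walk // ltnW.
by rewrite !(nth_power g0) ?well_coloured_string ?cyc_psi_coloured // ltnW.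
Qed.

Lemma psi_band_walk : band_walk z.
Proof.
split; last exact: power_psi_string.
- by have := power_psi_string 1; rewrite /power /= cats0.
- have := cyc_psi_walk; rewrite /cyc; have := size_psi_gt0.
  case: (z) => // g z' _ /(_ g (size z')); rewrite modnn /= modn_small //.
  by move=> e; rewrite (last_nth g) e.
exact: primitive_psi.
Qed.

Lemma W_cyc x0 i : W i = cyc x0 (rev w) i.
Proof.
rewrite /W /cyc size_map (nth_map x0) // ltn_pmod // size_rev; exact: size_w.
Qed.

Lemma clustering_unclustered : perfectly_clustering w <-> ~ unclustered W.
Proof.
have [x0 _] : exists x0 : 'I_n.-1, True by case: (w) size_w => // x; exists x.
have WE := W_cyc x0.
rewrite (perfectly_clusteringP x0 prim); split=> ncl uncl; apply: ncl.
  apply: unclustered_rev; case: uncl => i [j [l [lt1 eqt lt2]]].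
  exists i, j, l; rewrite !WE in lt1 lt2; split=> // t /eqt.
  by rewrite !WE => /val_inj.
rewrite -(revK w) in uncl.
have [i [j [l [lt1 eqt lt2]]]] := unclustered_rev uncl.
by exists i, j, l; rewrite !WE; split=> // t /eqt eqWt; rewrite !WE eqWt.
Qed.

Section Brick.
Variables (k : fieldType) (lambda : k) (hz : band_walk z).
Hypothesis lambda0 : lambda != 0.
Local Notation gam := (tnth (in_tuple z)).

Let g0 : letter (Qn n) := gam (Ordinal size_psi_gt0).
Definition pos u : 'I_R := Ordinal (ltn_pmod u size_psi_gt0).

Lemma gam_pos u : gam (pos u) = cyc g0 z u.
Proof. by rewrite (tnth_nth g0). Qed.

Lemma pos_val (u : 'I_R) : pos u = u.
Proof. by apply: val_inj; rewrite /= modn_small. Qed.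

Lemma ordS_pos u : ordS (pos u) = pos u.+1.
Proof. by apply: val_inj; rewrite /= -addn1 modnDml addn1. Qed.

Lemma gam_eq u s : gam (pos u) = gam (pos s) <-> Z u = Z s.
Proof.
rewrite !gam_pos -!(code_cyc g0); split=> [->//|].
by apply: code_inj; apply: cyc_psi_coloured.
Qed.

Lemma is_direct_pos u : is_direct (gam (pos u)) = (Z u).1.
Proof. by rewrite gam_pos -(code_cyc g0); case: (cyc _ _ _). Qed.

Lemma band_vertex_pos u s :
  band_vertex (pos u) = band_vertex (pos s) <->
  code_vertex (Z u) = code_vertex (Z s).
Proof.
rewrite /band_vertex !gam_pos -!(code_cyc g0) -!val_lsrc.
by split=> [->//|/val_inj].
Qed.

Lemma untwisted_diagonal (chi : 'I_R -> 'I_R -> k) :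
  untwisted_system chi -> diagonal_system Z (fun u s => chi (pos u) (pos s)).
Proof.
case=> diag eq1 eq2 eq3; split=> u s.
- by move=> neq; apply: diag => /band_vertex_pos.
- by move=> /gam_eq/eq1; rewrite !ordS_pos.
- by rewrite -!is_direct_pos => neq; apply: eq2 => /gam_eq.
by rewrite -!is_direct_pos -!ordS_pos => neq; apply: eq3 => /gam_eq.
Qed.

Lemma clustered_brick : ~ unclustered W -> brick (band_module lambda hz).
Proof.
move=> clW; apply: untwisted_brick => // [a|chi sys u s neq].
  exact: oriented_psi.
have r0 : (0 < size w)%N := size_w.
have W_mod i j : i = j %[mod size w] -> W i = W j.
  by move=> e; apply: cyc_eqmod; rewrite size_map size_rev.
rewrite -(pos_val u) -(pos_val s).
apply: (diagonal_system_diag Z_psi (untwisted_diagonal sys) r0 W_mod) => //.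
- move=> u' s'; rewrite -size_psi.
  by congr chi; apply: val_inj; rewrite /= modnDr.
- move=> i j eqW.
  have [x0 _] : exists x0 : 'I_n.-1, True by case: (w) size_w => // x; exists x.
  have := @cyc_aligned _ x0 (rev w) i j (primitive_rev prim); rewrite size_rev.
  by apply=> t; have := eqW t; rewrite !(W_cyc x0) => /val_inj.
by rewrite -size_psi !modn_small // => e; case/eqP: neq; apply: val_inj.
Qed.

(** An unclustered configuration gives an off-diagonal graph map, and [brick_untwisted] forbids it
    for any nonzero [lambda]. *)
Lemma brick_clustered : brick (band_module lambda hz) -> ~ unclustered W.
Proof.
move=> br /(unclustered_graph_map Z_psi)[a [b [m [start eqv eqZ stop]]]].
have Z_walk u s : Z u = Z s -> code_vertex (Z u.+1) = code_vertex (Z s.+1).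
  by rewrite -!(Z_adjacent Z_psi) => ->.
have sys := @graph_map_system Z k R a b m Z_mod start eqv eqZ stop Z_walk.
have modE u s u' s' : u = u' %[mod R] -> s = s' %[mod R] ->
    graph_map k R a b m u s = graph_map k R a b m u' s'.
  by rewrite /graph_map /on_segment => eu es; rewrite eu es.
pose chi (u s : 'I_R) : k := graph_map k R a b m u s.
have chiS u s : chi (ordS u) (ordS s) = graph_map k R a b m u.+1 s.+1.
  by apply: modE; rewrite /= modn_mod.
have sys' : untwisted_system chi.
  have gE (u s : 'I_R) : gam u = gam s <-> Z u = Z s.
    by have := gam_eq u s; rewrite !pos_val.
  have vE (u s : 'I_R) :
      band_vertex u = band_vertex s <-> code_vertex (Z u) = code_vertex (Z s).
    by have := band_vertex_pos u s; rewrite !pos_val.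
  have dE (u : 'I_R) : is_direct (gam u) = (Z u).1.
    by have := is_direct_pos u; rewrite !pos_val.
  case: sys => eq0 eq1 eq2 eq3; split=> u s'.
  - by move=> neq; apply: eq0 => /vE.
  - by move=> /gE/eq1 e; rewrite chiS -e.
  - by rewrite !dE => neq; apply: eq2 => /gE.
  by rewrite chiS !dE => neq; apply: eq3 => /gE.
(* The letters just before the two positions have opposite directions, so the positions differ
   modulo [R]. *)
have neq : pos a.+1 != pos b.+1.
  apply/eqP => /(congr1 val)/= /eqP; rewrite -[a.+1]addn1 -[b.+1]addn1.
  rewrite eqn_modDr => /eqP/Z_mod e; by move: start; rewrite e; case: (Z b).1.
have := brick_untwisted lambda0 (@oriented_psi n w) br sys' neq.
rewrite /chi (@modE _ _ a.+1 b.+1) ?modn_mod //.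
rewrite /graph_map (_ : on_segment _ _ _ _ _ _).
  by move/eqP; rewrite oner_eq0.
by apply/on_segmentP; exists 0%N; rewrite ?addn0.
Qed.

End Brick.
End PsiBand.

Theorem theorem1p1 (n : nat) (hn : (2 <= n)%N) (k : closedFieldType)
    (w : seq 'I_n.-1) (hw : primitive w) :
  exists hpsi : band_walk (psi w),
    [<-> perfectly_clustering w;
         exists2 lambda : k, lambda != 0 & brick (band_module lambda hpsi);
         forall lambda : k, lambda != 0 -> brick (band_module lambda hpsi)].
Proof.
exists (psi_band_walk hw); have cl := clustering_unclustered hw; tfae.
- move/cl => cw; exists 1; first exact: oner_neq0.
  by apply: clustered_brick; rewrite ?oner_neq0.
- case=> mu mu0 /(brick_clustered hw mu0) cw lambda lambda0.
  exact: clustered_brick.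
move=> br; have b1 := br 1 (oner_neq0 _).
exact/cl/(brick_clustered hw (oner_neq0 _) b1).
Qed.
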